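(* Let $p,q,Q,m,N_1,\dots,N_m,L$ be as in the context, let $J=\{1,2,\dots,m\}$, and let $\Delta=\bigcup_{l=1}^z\mathfrak{I}_{\boldsymbol{a}_l}$ with $\boldsymbol{a}_1,\dots,\boldsymbol{a}_z\in\mathcal{A}$ be a closed set. If the set $\{\sigma_L(\boldsymbol{a}_1),\sigma_L(\boldsymbol{a}_2),\dots,\sigma_L(\boldsymbol{a}_z)\}$ contains exactly $r\le q-2$ distinct values and these values are consecutive integers, then for any coordinate $t_0\in\{1,\dots,n_J\}$, the set $\mathrm{coord}(R_{t_0})$ is an $(r,q-r)$ recovery set for $t_0$, where $R_{t_0}$ is the orbit of $P_{t_0}\in Z_J$. Consequently $\mathcal{C}^J_\Delta$ is an LRC code with locality $(r,q-r)$, and its $t$-localities satisfy $r_{q-r-t}\le q-1-t$ for $t=1,2,\dots,q-r-1$.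
   Context: **Fields and varieties.** Let $p$ be a prime, $q=p^s$, $Q=p^\ell$ with $s\mid \ell$, so $\mathbb{F}_q\subseteq\mathbb{F}_Q$. Let $m\ge1$, $\mathfrak{R}=\mathbb{F}_Q[X_1,\dots,X_m]$, $X^{\boldsymbol{a}}=X_1^{a_1}\cdots X_m^{a_m}$. Fix integers $N_j>1$ ($1\le j\le m$) with $N_j-1$ dividing $Q-1$. Here $J=\{1,\dots,m\}$. Let $I_J\subset\mathfrak{R}$ be the ideal generated by $X_j^{N_j-1}-1$, $1\le j\le m$; $\mathfrak{R}_J=\mathfrak{R}/I_J$; $\mathcal{H}_J=\prod_{j=1}^m\{0,1,\dots,N_j-2\}$. Let $Z_J=\{P_1,\dots,P_{n_J}\}\subset\mathbb{F}_Q^m$ be the zero set of $I_J$, of size $n_J=\prod_j(N_j-1)$, and $\mathrm{ev}_J:\mathfrak{R}_J\to\mathbb{F}_Q^{n_J}$, $\mathrm{ev}_J(f)=(f(P_1),\dots,f(P_{n_J}))$. **Standing assumption.** $L$ is a fixed non-empty subset of $J$ such that $q-1$ divides $N_j-1$ for all $j\in L$. **Codes.** For non-empty $\Delta\subseteq\mathcal{H}_J$, $E^J_\Delta$ is the $\mathbb{F}_Q$-span of $\{\mathrm{ev}_J(X^{\boldsymbol{a}}):\boldsymbol{a}\in\Delta\}$, and $\mathcal{C}^J_\Delta=E^J_\Delta\cap\mathbb{F}_q^{n_J}$, a linear code over $\mathbb{F}_q$. **Cyclotomic sets.** Identify $\{0,\dots,N_j-2\}$ with $\mathbb{Z}/(N_j-1)\mathbb{Z}$;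 multiplication by $q$ on $\mathcal{H}_J$ is componentwise. Minimal cyclotomic sets are the sets $\{q^i\boldsymbol{y}:i\ge0\}$, $\boldsymbol{y}\in\mathcal{H}_J$; the representative of such a set is its lexicographically smallest element. $\mathcal{A}$ is the set of all representatives and $\mathfrak{I}_{\boldsymbol{a}}$ is the minimal cyclotomic set with representative $\boldsymbol{a}$. A closed set is a union of minimal cyclotomic sets. For $\boldsymbol{a}\in\mathcal{A}$, $\sigma_L(\boldsymbol{a})=\sum_{j\in L}a_j$, computed in $\mathbb{Z}$. **Orbits.** Let $\eta$ be a primitive element of $\mathbb{F}_q$. For $\lambda\in\mathbb{F}_Q^*$ and $P\in\mathbb{F}_Q^m$, $\lambda\cdot_LP$ is obtained from $P$ by multiplying by $\lambda$ the coordinates in positions in $L$, leaving the others unchanged. The orbit of $P_{t_0}\in Z_J$ is $R_{t_0}=\{\eta^n\cdot_LP_{t_0}:0\le n\le q-2\}\subseteq Z_J$. For $R\subseteq Z_J$, $\mathrm{coord}(R)=\{j:P_j\in R\}$. **Localities.** For a linear code $\mathcal{C}\subseteq\mathbb{F}_q^n$, $d(\cdot)$ is minimum distance, and for $\overline{R}\subseteq\{1,\dots,n\}$ the punctured code $\mathcal{C}[\overline{R}]$ is the projection of $\mathcal{C}$ onto the coordinates in $\overline{R}$. An $(r,\delta)$ recovery set for coordinate $i$ is a set $\overline{R}$ with $i\in\overline{R}$, $\#\overline{R}\le r+\delta-1$ and $d(\mathcal{C}[\overline{R}])\ge\delta$. $\mathcal{C}$ is an LRC code with locality $(r,\delta)$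 if every coordinate $i$ has an $(r,\delta)$ recovery set. For $t=1,\dots,d(\mathcal{C})-1$, the $t$-locality is $$r_t=r_t(\mathcal{C})=\min\{\rho:\ \text{for all } i \text{ there is } \overline{R}_i\subseteq\{1,\dots,n\} \text{ with } i\in\overline{R}_i,\ \#\overline{R}_i\le\rho,\ d(\mathcal{C}[\overline{R}_i])\ge t+1\}-1 .$$ *)

(* Defs.v *)
From HB Require Import structures.
From mathcomp Require Import all_boot all_order all_algebra.
From mathcomp Require Import mpoly.

Set Implicit Arguments.
Unset Strict Implicit.
Unset Printing Implicit Defensive.

Import Order.TTheory GRing.Theory Num.Theory.
Local Open Scope ring_scope.

Section MinimumDistance.

Variables (F : finFieldType) (n : nat).

Definition hamming (x y : 'rV[F]_n) : nat := #|[set i | x 0 i != y 0 i]|.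

(* The zero code has no minimum distance; the value 0 makes sure that a
   zero punctured code never counts as having distance >= 1. For a nonzero
   code the neutral value n of the minimum is harmless, since hamming <= n. *)
Definition mindist (C : {vspace 'rV[F]_n}) : nat :=
  if C == 0%VS then 0%N
  else \big[minn/n]_(u : 'rV[F]_n * 'rV[F]_n |
                     [&& u.1 \in C, u.2 \in C & u.1 != u.2]) hamming u.1 u.2.

End MinimumDistance.

Section Locality.

Variables (F : finFieldType) (n : nat).
Implicit Types (C : {vspace 'rV[F]_n}) (R : {set 'I_n}).

Definition proj R (c : 'rV[F]_n) : 'rV[F]_#|R| := colsub (@enum_val _ (mem R)) c.

Definition puncture C R : {vspace 'rV[F]_#|R|} := (linfun (proj R) @: C)%VS.

Definition recovery_set C (r delta : nat) (i : 'I_n) R : bool :=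
  [&& i \in R, (#|R| <= r + delta - 1)%N & (delta <= mindist (puncture C R))%N].

Definition LRC C (r delta : nat) : Prop :=
  forall i : 'I_n, exists R, recovery_set C r delta i R.

Definition t_local C (t rho : nat) : bool :=
  [forall i : 'I_n, exists R : {set 'I_n},
     [&& i \in R, (#|R| <= rho)%N & (t.+1 <= mindist (puncture C R))%N]].

(* r_t(C), meaningful for 1 <= t <= mindist C - 1: then rho = n qualifies
   (take R to be the set of all coordinates), so that the minimum over all
   rho is the minimum over rho <= n. *)
Definition t_locality C (t : nat) : nat :=
  ([arg min_(rho < ord_max | t_local C t (rho : 'I_n.+1)) (rho : nat)] - 1)%N.

Lemma proj_is_linear R : linear (proj R).
Proof. by move=> k x y; apply/rowP=> j; rewrite !mxE. Qed.

HB.instance Definition _ R :=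
  GRing.isLinear.Build F 'rV[F]_n 'rV[F]_#|R| _ (proj R) (proj_is_linear R).

Lemma mem_puncture C R (v : 'rV[F]_#|R|) :
  reflect (exists2 c, c \in C & v = proj R c) (v \in puncture C R).
Proof.
apply: (iffP memv_imgP) => -[c Cc ->]; exists c => //; first by rewrite lfunE.
by rewrite lfunE.
Qed.

End Locality.

Section Evaluation.

Variables (F : finFieldType) (m : nat) (N : 'I_m -> nat).

Definition nJ : nat := (\prod_(j < m) (N j - 1))%N.

Definition genJ (j : 'I_m) : {mpoly F[m]} := 'X_j ^+ (N j - 1)%N - 1.

Definition idealJ (f : {mpoly F[m]}) : Prop :=
  exists h : 'I_m -> {mpoly F[m]}, f = \sum_(j < m) h j * genJ j.

(* A point is a zero of I_J iff it is a zero of its generators. *)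
Definition ZJ : {set {ffun 'I_m -> F}} :=
  [set x : {ffun 'I_m -> F} | [forall j, (genJ j).@[x] == 0]].

Lemma ZJ_P (x : {ffun 'I_m -> F}) :
  reflect (forall f, idealJ f -> f.@[x] = 0) (x \in ZJ).
Proof.
rewrite inE; apply: (iffP forallP) => [zx f [h ->] | zx j].
  rewrite raddf_sum big1 //= => j _.
  by rewrite mevalM (eqP (zx j)) mulr0.
apply/eqP/zx; exists (fun k => (k == j)%:R).
rewrite (bigD1 j) //= eqxx mul1r big1 ?addr0 // => k /negPf->.
by rewrite mul0r.
Qed.

Variable P : 'I_nJ -> {ffun 'I_m -> F}.

(* ev_J, on representatives of the classes modulo I_J: see ev_ideal. *)
Definition ev (f : {mpoly F[m]}) : 'rV[F]_nJ := \row_t f.@[P t].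

Lemma ev_ideal (f g : {mpoly F[m]}) :
  codom P =i ZJ -> idealJ (f - g) -> ev f = ev g.
Proof.
move=> PZ Ifg; apply/rowP=> t; rewrite !mxE; apply/eqP.
by rewrite -subr_eq0 -mevalB (ZJ_P _ _ _ Ifg) // -PZ codom_f.
Qed.

(* H_J. The type 'I_(N j - 2).+1 is {0, ..., N_j - 2} when N_j > 1, and carries
   the additive group structure of Z/(N_j - 1)Z. *)
Definition HJ : finType := {dffun forall j : 'I_m, 'I_(N j - 2)%N.+1}.

Definition mon (a : HJ) : {mpoly F[m]} := 'X_[[multinom (a j : nat) | j < m]].

Definition EJ (D : {set HJ}) : {vspace 'rV[F]_nJ} :=
  <<[seq ev (mon a) | a in D]>>%VS.

(* Multiplication by q; *+ is computed in Z/(N_j - 1)Z. *)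
Definition qmul (q : nat) (a : HJ) : HJ := [ffun j => a j *+ q].

(* { q^i y : i >= 0 } *)
Definition cyclo (q : nat) (y : HJ) : {set HJ} := [set x | fconnect (qmul q) y x].

Definition lexword (a : HJ) : seqlexi nat := [seq (a j : nat) | j <- enum 'I_m].

Definition represents (S : {set HJ}) (a : HJ) : bool :=
  (a \in S) && [forall b in S, (lexword a <= lexword b)%O].

(* The set A of all representatives. As q is coprime to
   every N_j - 1, the minimal cyclotomic set with representative a is cyclo q a. *)
Definition reps (q : nat) : {set HJ} :=
  [set a | [exists y, represents (cyclo q y) a]].

Definition sigmaL (L : {set 'I_m}) (a : HJ) : nat := (\sum_(j in L) a j)%N.

Definition actL (L : {set 'I_m}) (lam : F) (x : {ffun 'I_m -> F}) :
    {ffun 'I_m -> F} :=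
  [ffun j => if j \in L then lam * x j else x j].

Definition coordJ (R : {set {ffun 'I_m -> F}}) : {set 'I_nJ} := [set t | P t \in R].

End Evaluation.

Section SubfieldSubcode.

(* The inclusion of F_q in F_Q is the field morphism emb. *)
Variables (Fq FQ : finFieldType) (emb : {rmorphism Fq -> FQ}).

(* E ∩ F_q^n; the set of such words is already a subspace: see mem_subcode. *)
Definition subcode (n : nat) (E : {vspace 'rV[FQ]_n}) : {vspace 'rV[Fq]_n} :=
  <<enum [set c : 'rV[Fq]_n | map_mx emb c \in E]>>%VS.

Lemma mem_subcode (n : nat) (E : {vspace 'rV[FQ]_n}) (c : 'rV[Fq]_n) :
  (c \in subcode E) = (map_mx emb c \in E).
Proof.
apply/idP/idP => [/coord_span -> | Ec]; last first.
  by apply: memv_span; rewrite mem_enum inE.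
rewrite raddf_sum; apply: memv_suml => i _ /=.
rewrite map_mxZ memvZ //.
have lt_i: (i < size (enum [set c : 'rV[Fq]_n | map_mx emb c \in E]))%N by rewrite -cardE.
by have := mem_nth 0 lt_i; rewrite mem_enum inE.
Qed.

Variables (m : nat) (N : 'I_m -> nat).

Definition codeJ (P : 'I_(nJ N) -> {ffun 'I_m -> FQ}) (D : {set HJ N}) :
    {vspace 'rV[Fq]_(nJ N)} :=
  subcode (EJ P D).

(* { eta^n ._L x : 0 <= n <= q - 2 } *)
Definition orbitL (q : nat) (eta : Fq) (L : {set 'I_m}) (x : {ffun 'I_m -> FQ}) :
    {set {ffun 'I_m -> FQ}} :=
  [set actL L (emb eta ^+ (n : nat)) x | n : 'I_(q - 1)%N].

End SubfieldSubcode.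

(* Main.v *)
(** Let x be a point and lam a scalar of F_q^*. On lam ._L x a monomial X^c takes
    the value lam^sigma_L(c) X^c(x), and since lam^q = lam the exponent may be
    replaced by sigma_L of the representative of the cyclotomic set of c. Hence,
    along an orbit, a codeword is lam |-> lam^b g(lam), where b is the least value
    of sigma_L on the representatives and g is a polynomial over F_Q of degree
    less than r. It vanishes at most r - 1 times on any part of the orbit, unless
    it vanishes identically. Traces of multiples of one monomial provide, for each
    coordinate, a codeword which is not zero there, so that the punctured codes
    are not zero. For the t-localities, remove t - 1 points from the orbit. *)

Require Import Defs.
From HB Require Import structures.
From mathcomp Require Import all_boot all_order all_algebra finfield.
From mathcomp Require Import mpoly zify.

Set Implicit Arguments.
Unset Strict Implicit.
Unset Printing Implicit Defensive.

Import Order.TTheory GRing.Theory Num.Theory.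
Local Open Scope nat_scope.

(** * Monomials on [ZJ]: Frobenius and scaling *)

Section Monomials.

Variables (F : finFieldType) (m : nat) (N : 'I_m -> nat).
Hypothesis hN : forall j, 1 < N j.
Implicit Types (x : {ffun 'I_m -> F}) (a : HJ N) (L : {set 'I_m}).

Lemma nJ_gt0 : 0 < nJ N.
Proof. by apply: prodn_gt0 => j; rewrite subn_gt0. Qed.

Lemma mem_ZJ x : (x \in ZJ F N) = [forall j, (x j ^+ (N j - 1)%N == 1)%R].
Proof.
rewrite inE; apply: eq_forallb => j.
by rewrite /genJ mevalB rmorphXn /= mevalXU meval1 subr_eq0.
Qed.

Lemma ZJ_unity x j : x \in ZJ F N -> (x j ^+ (N j - 1)%N = 1)%R.
Proof. by rewrite mem_ZJ => /forallP/(_ j)/eqP. Qed.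

Lemma ZJ_neq0 x j : x \in ZJ F N -> x j != 0%R.
Proof.
move=> /(@ZJ_unity _ j) xj1; apply: contra_eqN xj1 => /eqP->.
by rewrite expr0n subn_eq0 leqNgt hN eq_sym oner_eq0.
Qed.

Lemma meval_mon a x : ((mon F a).@[x] = \prod_j x j ^+ a j)%R.
Proof.
by rewrite /mon mevalX; apply: eq_bigr => j _; rewrite mnmE.
Qed.

Lemma meval_mon_neq0 a x : x \in ZJ F N -> ((mon F a).@[x] != 0)%R.
Proof.
move=> Zx; rewrite meval_mon; apply/prodf_neq0 => j _.
by rewrite expf_neq0 // ZJ_neq0.
Qed.

(** Reducing exponents modulo [N j - 1] does not change values, because coordinates of points of
    [ZJ] are roots of unity of that exponent. *)
Lemma meval_mon_iter_qmul q i a x : x \in ZJ F N ->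
  ((mon F (iter i (qmul q) a)).@[x] = (mon F a).@[x] ^+ (q ^ i)%N)%R.
Proof.
move=> Zx; elim: i => [|i IHi] /=; first by rewrite expn0 expr1.
rewrite expnSr exprM -IHi !meval_mon -prodrXl; apply: eq_bigr => j _.
rewrite ffunE Zp_mulrn /= -exprM.
by apply: expr_mod; rewrite -subSn ?hN // ZJ_unity.
Qed.

Lemma meval_mon_actL L lam a x :
  ((mon F a).@[actL L lam x] = lam ^+ sigmaL L a * (mon F a).@[x])%R.
Proof.
rewrite !meval_mon /sigmaL -prodrXr [X in (X * _)%R]big_mkcond -big_split /=.
apply: eq_bigr => j _; rewrite ffunE.
by case: ifP => _; rewrite ?exprMn ?mul1r.
Qed.

Lemma actL_ZJ L lam q x : (forall j, j \in L -> q - 1 %| N j - 1) ->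
  (lam ^+ (q - 1)%N = 1)%R -> x \in ZJ F N -> actL L lam x \in ZJ F N.
Proof.
move=> hL lam1 Zx; rewrite mem_ZJ; apply/forallP => j; rewrite ffunE.
case: ifP => [/hL/dvdnP[k Nk] | _]; last by rewrite ZJ_unity.
by rewrite exprMn ZJ_unity // mulr1 Nk mulnC exprM lam1 expr1n.
Qed.

End Monomials.

(** * Frobenius and trace from [FQ] to [Fq] *)

Section Trace.

Variables (Fq FQ : finFieldType) (emb : {rmorphism Fq -> FQ}) (q : nat).
Hypothesis cardFq : #|Fq| = q.

Lemma emb_expr_card (y : Fq) : (emb y ^+ q = emb y)%R.
Proof. by rewrite -rmorphXn -cardFq expf_card. Qed.

Lemma q_gt1 : 1 < q.
Proof. by rewrite -cardFq finNzRing_gt1. Qed.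

(** The image of [emb] already supplies [q] roots of ['X^q - 'X]; one more would exceed the
    degree. *)
Lemma codom_emb (x : FQ) : (x ^+ q = x)%R -> x \in codom emb.
Proof.
move=> xq; have q1 := q_gt1; apply: contraT => x_emb.
pose pol : {poly FQ} := ('X^q - 'X)%R.
have size_pol : size pol = q.+1.
  by rewrite size_polyDl size_polyXn // size_polyN size_polyX.
have pol0 : pol != 0%R by rewrite -size_poly_eq0 size_pol.
have /(max_poly_roots pol0) : all (root pol) (x :: codom emb).
  apply/allP => y; rewrite inE => /predU1P[-> | /codomP[z ->]];
    by rewrite rootE !hornerE ?hornerXn ?xq ?emb_expr_card subrr.
rewrite /= x_emb map_inj_uniq ?enum_uniq; last exact: fmorph_inj.
by move=> /(_ isT); rewrite size_pol size_codom cardFq ltnn.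
Qed.

(** This makes raising to the power [q] additive on [FQ]. *)
Lemma pnat_card_FQ : ([pchar FQ]%R).-nat q.
Proof.
have [p p_pr charFq] := finPcharP Fq.
rewrite -cardFq (card_pprimeChar charFq) pnatX.
by rewrite (eq_pnat _ (pcharf_eq (rmorph_pchar emb charFq))) pnat_id.
Qed.

Lemma expr_card_sum (I : Type) (s : seq I) (f : I -> FQ) :
  ((\sum_(i <- s) f i) ^+ q = \sum_(i <- s) f i ^+ q)%R.
Proof.
apply: (big_morph (fun x : FQ => x ^+ q)%R) => [x y|].
  by rewrite exprDn_pchar // pnat_card_FQ.
by rewrite expr0n; case: q q_gt1.
Qed.

(* The trace polynomial has degree q ^ e.-1 < #|FQ|. *)
Lemma trace_neq0 e : 0 < e -> #|FQ| = q ^ e ->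
  exists y : FQ, (\sum_(i < e) y ^+ (q ^ i)%N != 0)%R.
Proof.
case: e => // e _ cardFQ; have q1 := q_gt1.
pose pol : {poly FQ} := (\sum_(i < e.+1) 'X^(q ^ i)%N)%R.
have size_pol : size pol = (q ^ e).+1.
  rewrite /pol big_ord_recr /= addrC size_polyDl size_polyXn // ltnS.
  apply: (leq_trans (size_sum _ _ _)); apply/bigmax_leqP => i _.
  by rewrite size_polyXn ltn_exp2l.
have pol0 : pol != 0%R by rewrite -size_poly_eq0 size_pol.
apply/existsP; apply: contraT; rewrite negb_exists => /forallP trace0.
have /(max_poly_roots pol0) : all (root pol) (enum FQ).
  apply/allP => y _; rewrite rootE horner_sum.
  by under eq_bigr do rewrite hornerXn; exact: negbNE (trace0 y).
move=> /(_ (enum_uniq _)); rewrite size_pol -cardE cardFQ ltnS.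
by rewrite leq_exp2l // ltnn.
Qed.

End Trace.

(** * Bounding the minimum distance and the t-locality *)

Section MinimumDistance.

Variables (F : finFieldType) (n : nat).

Lemma hamming_max (u v : 'rV[F]_n) : hamming u v <= n.
Proof. by rewrite -[n in _ <= n]card_ord max_card. Qed.

Lemma mindist_ge (C : {vspace 'rV[F]_n}) (d : nat) (c : 'rV[F]_n) :
  c \in C -> c != 0%R ->
  (forall u v, u \in C -> v \in C -> u != v -> d <= hamming u v) ->
  d <= mindist C.
Proof.
move=> Cc c0 dmin; rewrite /mindist ifN; last first.
  by apply: contraNneq c0 => C0; rewrite -memv0 -C0.
(* The neutral value [n] of the minimum must also be at least [d]; the distance from [c] to 0 shows
   it. *)
have le_dn : d <= n by apply: leq_trans (hamming_max _ _); apply: dmin c0; rewrite ?mem0v.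
elim/big_ind: _ => [//|x y dx dy|[u v] /and3P[]]; last exact: dmin.
by rewrite leq_min dx.
Qed.

End MinimumDistance.

Lemma t_locality_leq (F : finFieldType) (n : nat) (C : {vspace 'rV[F]_n})
    (t rho : nat) :
  rho <= n -> t_local C t rho -> t_locality C t <= rho - 1.
Proof.
rewrite -ltnS => lt_rho loc_rho; rewrite /t_locality leq_sub2r //.
(* Monotonicity is needed because the default [ord_max] of the arg min must itself qualify. *)
have loc_mono k : rho <= k -> t_local C t k.
  move=> le_k; apply/forallP => i; have /existsP[R /and3P[Ri Rk dR]] := forallP loc_rho i.
  by apply/existsP; exists R; rewrite Ri dR (leq_trans Rk).
case: arg_minnP => [|k _ /(_ (Ordinal lt_rho) loc_rho)//]; exact: loc_mono.
Qed.

(** * Codewords restricted to orbits *)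

Section OrbitCode.

Variables (Fq FQ : finFieldType) (emb : {rmorphism Fq -> FQ}) (q m : nat).
Hypothesis cardFq : #|Fq| = q.
Variable N : 'I_m -> nat.
Hypothesis hN : forall j, 1 < N j.
Variable P : 'I_(nJ N) -> {ffun 'I_m -> FQ}.
Hypotheses (P_inj : injective P) (P_codom : codom P =i ZJ FQ N).
Variable L : {set 'I_m}.
Hypothesis hL : forall j, j \in L -> q - 1 %| N j - 1.
Variable j0 : 'I_m.
Hypothesis Lj0 : j0 \in L.
Variable eta : Fq.
Hypothesis heta : ((q - 1)%N.-primitive_root eta)%R.
Variables (z : nat) (a : 'I_z -> HJ N) (b r : nat).
Hypothesis sigma_a : forall k, b <= sigmaL L (a k) < b + r.

Let Delta := \bigcup_(k < z) cyclo q (a k).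
Let C := codeJ emb P Delta.
Let orbit t0 := coordJ P (orbitL emb q eta L (P t0)).
(** Recovers the scalar carrying [P t0] to [P t] along an orbit, read off at one coordinate [j0] of
    [L]. *)
Let ratio t0 t : FQ := (P t j0 / P t0 j0)%R.

Lemma point_ZJ t : P t \in ZJ FQ N.
Proof. by rewrite -P_codom codom_f. Qed.

Lemma emb_eta_unity n : ((emb eta ^+ n) ^+ (q - 1)%N = 1)%R.
Proof.
by rewrite exprAC -rmorphXn (prim_expr_order heta) rmorph1 expr1n.
Qed.

Lemma orbit_ratio t0 t : t \in orbit t0 ->
  P t = actL L (ratio t0 t) (P t0) /\ (ratio t0 t ^+ (q - 1)%N = 1)%R.
Proof.
rewrite inE => /imsetP[n _ Pt].
suff -> : ratio t0 t = (emb eta ^+ n)%R by split; last exact: emb_eta_unity.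
by rewrite /ratio Pt ffunE Lj0 mulfK // (ZJ_neq0 hN) ?point_ZJ.
Qed.

Lemma card_orbit t0 : #|orbit t0| = q - 1.
Proof.
rewrite -(card_imset _ P_inj).
have -> : P @: orbit t0 = orbitL emb q eta L (P t0).
  apply/setP => x; apply/imsetP/idP => [[t Rt ->] | Rx].
    by rewrite inE in Rt.
  have : x \in codom P.
    have [n _ ->] := imsetP Rx.
    by rewrite P_codom (actL_ZJ hL) ?point_ZJ // emb_eta_unity.
  by move=> /codomP[t xt]; exists t; rewrite ?inE -?xt.
(* The nonzero coordinate at [j0] cancels, and primitivity of [eta] separates its powers. *)
rewrite card_imset ?card_ord // => n n' /ffunP/(_ j0).
rewrite !ffunE Lj0 => /(mulIf (ZJ_neq0 hN j0 (point_ZJ t0))).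
rewrite -!rmorphXn => /fmorph_inj/eqP.
by rewrite (eq_prim_root_expr heta) !modn_small // => /eqP/val_inj.
Qed.

Lemma mem_orbit t0 : t0 \in orbit t0.
Proof.
have q1 : 0 < q - 1 by rewrite subn_gt0 (q_gt1 cardFq).
rewrite inE; apply/imsetP; exists (Ordinal q1) => //=.
by apply/ffunP => j; rewrite ffunE mul1r if_same.
Qed.

(* Frobenius fixes the scalar lam, so that all monomials of a cyclotomic set
   scale along an orbit by the same power of lam. *)
Lemma mon_orbit x lam (y c : HJ N) : x \in ZJ FQ N -> (lam ^+ (q - 1)%N = 1)%R ->
  c \in cyclo q y ->
  ((mon FQ c).@[actL L lam x] = lam ^+ sigmaL L y * (mon FQ c).@[x])%R.
Proof.
move=> Zx lam1; rewrite inE => /iter_findex <-.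
rewrite !meval_mon_iter_qmul ?(actL_ZJ hL) // meval_mon_actL exprMn.
congr (_ * _)%R; rewrite exprAC; congr (_ ^+ _)%R.
elim: (findex _ _ _) => [|i IHi]; first by rewrite expr1.
by rewrite expnSr exprM IHi -(subnK (ltnW (q_gt1 cardFq))) exprD lam1 mul1r.
Qed.

(** Each monomial contributes a single power of [lam], with exponent in [[b, b + r)]; factoring out
    [lam ^+ b] leaves degrees below [r]. *)
Lemma EJ_orbit_poly t0 w : w \in EJ P Delta ->
  exists2 g : {poly FQ}, size g <= r &
    forall t lam, (lam ^+ (q - 1)%N = 1)%R -> P t = actL L lam (P t0) ->
      (w 0 t = lam ^+ b * g.[lam])%R.
Proof.
move=> /coord_span ->; elim/big_ind: _ => [|u v [g sg ug] [h sh vh]|i _].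
- by exists 0%R => [|t lam _ _]; rewrite ?size_poly0 // mxE horner0 mulr0.
- exists (g + h)%R => [|t lam lam1 Pt].
    by apply: leq_trans (size_polyD _ _) _; rewrite geq_max sg.
  by rewrite mxE hornerD mulrDr (ug t lam) // (vh t lam).
have lt_i : i < size [seq ev P (mon FQ c) | c in Delta] by rewrite size_image.
have /mapP[c] := mem_nth 0%R lt_i; rewrite mem_enum => /bigcupP[k _ ck] ->.
have /andP[bk kr] := sigma_a k.
set x := coord _ _ _.
exists ((x * (mon FQ c).@[P t0]) *: 'X^(sigmaL L (a k) - b))%R => [|t lam lam1 Pt].
  by apply: leq_trans (size_scale_leq _ _) _; rewrite size_polyXn ltn_subLR.
rewrite !mxE Pt (mon_orbit (point_ZJ _) lam1 ck) hornerZ hornerXn.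
by rewrite [RHS]mulrCA -exprD subnKC // [LHS]mulrCA mulrC.
Qed.

Lemma puncture_sub_lift (R : {set 'I_(nJ N)}) (u v : 'rV[Fq]_#|R|) :
  u \in puncture C R -> v \in puncture C R ->
  exists2 w : 'rV[FQ]_(nJ N), w \in EJ P Delta &
    forall i, (w 0 (enum_val i) = emb (u 0 i - v 0 i))%R.
Proof.
move=> /mem_puncture[c Cc ->] /mem_puncture[c' Cc' ->].
exists (map_mx emb (c - c')) => [|i]; last by rewrite !mxE.
by rewrite -mem_subcode rpredB.
Qed.

(** Positions where [u] and [v] agree give distinct roots of one nonzero polynomial of size at most
    [r], so there are fewer than [r] of them. *)
Lemma hamming_orbit t0 (R : {set 'I_(nJ N)}) (u v : 'rV[Fq]_#|R|) :
  R \subset orbit t0 -> u \in puncture C R -> v \in puncture C R -> u != v ->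
  #|R| < hamming u v + r.
Proof.
move=> /subsetP RO Cu Cv neq_uv.
have [w Ew wE] := puncture_sub_lift Cu Cv.
have [g sg wg] := EJ_orbit_poly t0 Ew.
have ratioP (i : 'I_#|R|) := orbit_ratio (RO _ (enum_valP i)).
(* The factor [lam ^+ b] is nonzero, so agreement and vanishing of [g] are equivalent. *)
have g_uv (i : 'I_#|R|) : root g (ratio t0 (enum_val i)) = (u 0%R i == v 0%R i).
  have [Pi lam1] := ratioP i.
  rewrite -subr_eq0 -(fmorph_eq0 emb) -wE (wg _ _ lam1 Pi) mulf_eq0 expf_eq0.
  by rewrite mulf_eq0 invr_eq0 !(negPf (ZJ_neq0 hN _ (point_ZJ _))) andbF.
have g0 : g != 0%R.
  apply: contraNneq neq_uv => g0; apply/eqP/rowP => i; apply/eqP.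
  by rewrite -g_uv g0 root0.
pose rs := [seq ratio t0 (enum_val i) | i in [set i | u 0%R i == v 0%R i]].
have : size rs < size g.
  apply: max_poly_roots => //.
    by apply/allP => _ /imageP[i + ->]; rewrite inE g_uv.
  rewrite map_inj_uniq ?enum_uniq // => i i' eq_ratio; apply/enum_val_inj/P_inj.
  by rewrite (ratioP i).1 (ratioP i').1 eq_ratio.
rewrite size_image => /leq_trans/(_ sg) agree_lt.
rewrite -[X in X < _]card_ord -(cardsC [set i | u 0%R i == v 0%R i]) addnC.
rewrite (_ : ~: _ = [set i | u 0%R i != v 0%R i]) ?ltn_add2l //.
by apply/setP => i; rewrite !inE.
Qed.

(* The traces of the multiples of a monomial are codewords, and one of them
   does not vanish at t0. *)
Lemma codeJ_nonzero_at e t0 : 0 < e -> #|FQ| = q ^ e -> 0 < z ->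
  exists2 c, c \in C & (c 0 t0 != 0)%R.
Proof.
move=> e0 cardFQ z0; pose y := a (Ordinal z0).
have [theta tr_theta] := trace_neq0 cardFq e0 cardFQ.
pose M i t : FQ := ((mon FQ (iter i (qmul q) y)).@[P t])%R.
have ME i t : (M i t = M 0%N t ^+ (q ^ i)%N)%R.
  by rewrite /M meval_mon_iter_qmul ?point_ZJ.
have M0 : M 0%N t0 != 0%R by rewrite meval_mon_neq0 ?point_ZJ.
(* Normalised so that the entry of [w] at [t0] is the trace of [theta]. *)
pose gam := (theta / M 0%N t0)%R.
pose w : 'rV[FQ]_(nJ N) := (\row_t \sum_(i < e) gam ^+ (q ^ i)%N * M i t)%R.
have wE t : (w 0 t = \sum_(i < e) (gam * M 0%N t) ^+ (q ^ i)%N)%R.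
  by rewrite mxE; apply: eq_bigr => i _; rewrite (ME i) [RHS]exprMn.
have Ew : w \in EJ P Delta.
  have -> : w = (\sum_(i < e) gam ^+ (q ^ i)%N *: ev P (mon FQ (iter i (qmul q) y)))%R.
    by apply/rowP => t; rewrite mxE summxE; apply: eq_bigr => i _; rewrite !mxE.
  apply: memv_suml => i _; apply/memvZ/memv_span/map_f; rewrite mem_enum.
  by apply/bigcupP; exists (Ordinal z0); rewrite // inE fconnect_iter.
(* Frobenius permutes the summands cyclically: the last one returns to the first, as
   [x ^+ #|FQ| = x]. *)
have wq t : (w 0 t ^+ q = w 0 t)%R.
  rewrite wE; set x := (gam * _)%R.
  rewrite (expr_card_sum emb cardFq) -[e]prednK // big_ord_recr big_ord_recl /=.
  rewrite expr1 addrC -exprM -expnSr prednK // -cardFQ expf_card.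
  by congr (_ + _)%R; apply: eq_bigr => i _; rewrite -exprM -expnSr.
pose c : 'rV[Fq]_(nJ N) := (\row_t iinv (codom_emb emb cardFq (wq t)))%R.
have wc : map_mx emb c = w by apply/rowP => t; rewrite !mxE f_iinv.
exists c; first by rewrite mem_subcode wc.
apply: contraNneq tr_theta => ct0; move/rowP/(_ t0): wc.
rewrite mxE ct0 rmorph0 wE => /esym/eqP.
by under eq_bigr do rewrite divfK //.
Qed.

(** Stated for any part of an orbit: the whole orbit gives recovery sets, smaller parts give the
    t-localities. *)
Lemma mindist_puncture_orbit e t0 (R : {set 'I_(nJ N)}) :
  0 < e -> #|FQ| = q ^ e -> 0 < z -> t0 \in R -> R \subset orbit t0 ->
  #|R|.+1 - r <= mindist (puncture C R).
Proof.
move=> e0 cardFQ z0 Rt0 RO; have [c Cc ct0] := codeJ_nonzero_at t0 e0 cardFQ z0.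
apply: (@mindist_ge _ _ _ _ (proj R c)) => [||u v Cu Cv neq_uv].
- by apply/mem_puncture; exists c.
- apply: contraNneq ct0 => /rowP/(_ (enum_rank_in Rt0 t0)).
  by rewrite !mxE enum_rankK_in // => ->.
- by rewrite leq_subLR addnC (hamming_orbit RO).
Qed.

Lemma recovery_set_orbit e t0 : 0 < e -> #|FQ| = q ^ e -> 0 < z -> r <= q ->
  recovery_set C r (q - r) t0 (orbit t0).
Proof.
move=> e0 cardFQ z0 rq; have q1 := q_gt1 cardFq.
apply/and3P; split; first exact: mem_orbit.
  by rewrite card_orbit subnKC.
apply: leq_trans (mindist_puncture_orbit e0 cardFQ z0 (mem_orbit t0) (subxx _)).
by rewrite card_orbit; lia.
Qed.

(** Distinct codewords differ at some [t], hence in at least [q - r] places of the orbit of [t]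
    alone. *)
Lemma mindist_codeJ e : 0 < e -> #|FQ| = q ^ e -> 0 < z -> q - r <= mindist C.
Proof.
move=> e0 cardFQ z0; have q1 := q_gt1 cardFq.
have [c Cc ct0] := codeJ_nonzero_at (Ordinal (nJ_gt0 hN)) e0 cardFQ z0.
apply: mindist_ge Cc _ _ => [|u v Cu Cv neq_uv].
  by apply: contraNneq ct0 => ->; rewrite mxE.
have [t ut_vt] : exists t, u 0%R t != v 0%R t.
  apply/existsP; apply: contraR neq_uv; rewrite negb_exists => /forallP uv.
  by apply/eqP/rowP => t; apply/eqP/negbNE/uv.
have puncture_mem x : x \in C -> proj (orbit t) x \in puncture C (orbit t).
  by move=> Cx; apply/mem_puncture; exists x.
have neq_proj : proj (orbit t) u != proj (orbit t) v.
  apply: contraNneq ut_vt => /rowP/(_ (enum_rank_in (mem_orbit t) t)).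
  by rewrite !mxE enum_rankK_in ?mem_orbit // => ->.
have := hamming_orbit (subxx _) (puncture_mem _ Cu) (puncture_mem _ Cv) neq_proj.
move=> lt_hamming.
apply: (@leq_trans (hamming (proj (orbit t) u) (proj (orbit t) v))).
  by move: (card_orbit t) q1; lia.
rewrite /hamming -(card_imset _ (@enum_val_inj _ (orbit t))) subset_leq_card //.
by apply/subsetP => _ /imsetP[i + ->]; rewrite !inE !mxE.
Qed.

Lemma t_local_codeJ e t : 0 < e -> #|FQ| = q ^ e -> 0 < z -> 0 < t < q - r ->
  t_local C (q - r - t) (q - t).
Proof.
move=> e0 cardFQ z0 /andP[t0 tr]; have q1 := q_gt1 cardFq.
apply/forallP => i.
have [R [cardR Ri RO]] : exists R : {set 'I_(nJ N)},
    [/\ #|R| = q - t, i \in R & R \subset orbit i].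
  (* [R] will be [i] together with [q - t - 1] other points of its orbit; then [#|R|.+1 - r] is the
     required [(q - r - t).+1]. *)
  have : q - t.+1 <= #|orbit i :\ i|.
    have := cardsD1 i (orbit i); rewrite mem_orbit card_orbit add1n.
    by move: #|_| => k; lia.
  move=> /card_geqP[s [us sz ss]].
  exists (i |: [set:: s]); split; first 1 last.
  - by rewrite setU11.
  - apply/subsetP => x; rewrite !inE => /predU1P[->|/ss].
      by have := mem_orbit i; rewrite inE.
    by rewrite !inE => /andP[].
  rewrite cardsU1 inE cardsE (card_uniqP us) sz.
  by have -> : i \notin s; [apply/negP => /ss; rewrite !inE eqxx | lia].
apply/existsP; exists R; apply/and3P; split; rewrite ?cardR //.
apply: leq_trans (mindist_puncture_orbit e0 cardFQ z0 Ri RO).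
by rewrite cardR; lia.
Qed.

End OrbitCode.

(** The bound by [mindist C - 1] records that [q - r - t] is in the range where the t-locality is
    meaningful. *)
Theorem theorem2p14
  (p s l q Q m : nat)
  (hp : prime p) (hq : q = p ^ s) (hQ : Q = p ^ l) (hsl : s %| l)
  (Fq FQ : finFieldType) (cardFq : #|Fq| = q) (cardFQ : #|FQ| = Q)
  (emb : {rmorphism Fq -> FQ})
  (hm : 1 <= m)
  (N : 'I_m -> nat)
  (hN : forall j, 1 < N j) (hNQ : forall j, N j - 1 %| Q - 1)
  (P : 'I_(nJ N) -> {ffun 'I_m -> FQ})
  (P_inj : injective P) (P_codom : codom P =i ZJ FQ N)
  (L : {set 'I_m}) (hL0 : L != set0)
  (hL : forall j, j \in L -> q - 1 %| N j - 1)
  (eta : Fq) (heta : ((q - 1)%N.-primitive_root eta)%R)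
  (z : nat) (hz : 0 < z) (a : 'I_z -> HJ N)
  (ha : forall k, a k \in reps N q)
  (r : nat) (hr : r <= q - 2)
  (h_distinct : size (undup [seq sigmaL L (a k) | k : 'I_z]) = r)
  (h_consec : exists b : nat,
     forall v : nat,
       (v \in [seq sigmaL L (a k) | k : 'I_z]) = (b <= v < b + r)) :
  let Delta := \bigcup_(k < z) cyclo q (a k) in
  let C := codeJ emb P Delta in
  [/\ forall t0 : 'I_(nJ N),
        recovery_set C r (q - r) t0 (coordJ P (orbitL emb q eta L (P t0))),
      LRC C r (q - r)
    & forall t : nat, 1 <= t <= q - r - 1 ->
        q - r - t <= mindist C - 1 /\ t_locality C (q - r - t) <= q - 1 - t].
Proof.
move=> Delta C; have [b hb] := h_consec.
have sigma_a k : b <= sigmaL L (a k) < b + r by rewrite -hb; apply/imageP; exists k.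
have r0 : 0 < r by have := sigma_a (Ordinal hz); lia.
have [j0 Lj0] := set0Pn _ hL0.
have [e le] := dvdnP hsl.
have cardFQe : #|FQ| = q ^ e by rewrite cardFQ hQ hq -expnM mulnC -le.
have e0 : 0 < e.
  by case: e cardFQe {le} => // cardFQ1; have := finNzRing_gt1 FQ; rewrite cardFQ1.
have rec_orbit t0 : recovery_set C r (q - r) t0 (coordJ P (orbitL emb q eta L (P t0))).
  apply: (recovery_set_orbit emb cardFq hN P_inj P_codom hL Lj0 heta sigma_a
    t0 e0) => //.
  by lia.
split=> // [i | t /andP[t0 tq]].
  by exists (coordJ P (orbitL emb q eta L (P i))).
have dC : q - r <= mindist C.
  exact: (mindist_codeJ emb cardFq hN P_inj P_codom hL Lj0 heta sigma_a e0).
split; first lia.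
have t_loc : t_local C (q - r - t) (q - t).
  by apply: (t_local_codeJ emb cardFq hN P_inj P_codom hL Lj0 heta sigma_a e0) => //; lia.
(* The minimum defining [t_locality] ranges over sizes up to the length; an orbit of [q - 1]
   coordinates shows that [q - t] is among them. *)
have le_n : q - t <= nJ N.
  apply: (@leq_trans (q - 1)); first lia.
  rewrite -(card_orbit emb hN P_inj P_codom hL Lj0 heta (Ordinal (nJ_gt0 hN))).
  by rewrite -[X in _ <= X]card_ord max_card.
by have := t_locality_leq le_n t_loc; lia.
Qed.
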